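(* For any positive integers $M$ and $k$ and any Boolean function $f:\{0,1,\dots,N-1\}\to\{0,1\}$ with $t=|f^{-1}(1)|$, the algorithm $\mathbf{Count}(f,M)$ outputs an estimate $t'$ such that $$|t'-t|\le 2\pi k\frac{\sqrt{t(N-t)}}{M}+\pi^2k^2\frac{N}{M^2}$$ with probability at least $8/\pi^2$ when $k=1$, and with probability greater than $1-\frac{1}{2(k-1)}$ when $k\ge2$. If $t=0$ then $t'=0$ with certainty, and if $t=N$ and $M$ is even then $t'=N$ with certainty.
   Context: For $M\ge1$, $\mathbf F_M|x\rangle=\frac{1}{\sqrt M}\sum_{y=0}^{M-1}e^{2\pi ixy/M}|y\rangle$. For a unitary $\mathbf U$, $\Lambda_M(\mathbf U)$ is $|j\rangle|y\rangle\mapsto|j\rangle(\mathbf U^j|y\rangle)$, $0\le j<M$. Take $\mathcal H$ with basis $|0\rangle,\dots,|N-1\rangle$, $\mathcal A=\mathbf F_N$, $\chi=f$, $\mathbf S_f|x\rangle=(-1)^{f(x)}|x\rangle$, $\mathbf S_0$ negating $|0\rangle$ and fixing other basis states, and $\mathbf Q=-\mathcal A\mathbf S_0\mathcal A^{-1}\mathbf S_f$. $\mathbf{Est\_Amp}(\mathcal A,f,M)$: prepare $|0\rangle\otimes\mathcal A|0\rangle$ (first register $M$-dimensional); apply $\mathbf F_M$ to the first register; apply $\Lambda_M(\mathbf Q)$; apply $\mathbf F_M^{-1}$ to the first register; measure the first register obtaining $y$; output $\sin^2(\pi y/M)$. Algorithm $\mathbf{Count}(f,M)$ outputs $t'=N\cdot\mathbf{Est\_Amp}(\mathbf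 F_N,f,M)$. *)

(* Defs.v *)
From HB Require Import structures.
From mathcomp Require Import all_boot all_order all_algebra.
From mathcomp Require Import complex.
From mathcomp Require Import reals trigo.
Set Implicit Arguments. Unset Strict Implicit. Unset Printing Implicit Defensive.
Import Order.TTheory GRing.Theory Num.Theory.
Local Open Scope ring_scope.
Local Open Scope complex_scope.

Section QC.
Variable R : realType.
Local Notation C := R[i].

Definition expi (th : R) : C := Complex (cos th) (sin th).

Definition sqnorm (z : C) : R := (complex.Re z) ^+ 2 + (complex.Im z) ^+ 2.

Definition QFT (M : nat) : 'M[C]_M :=
  \matrix_(y < M, x < M)
     ((Num.sqrt (M%:R : R))^-1 %:C * expi (2 * pi * (x%:R * y%:R) / M%:R)).

Definition ket0 (n : nat) : 'cV[C]_n := \col_(i < n) (((i : nat) == 0%N)%:R).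

Definition S_f (N : nat) (f : 'I_N -> bool) : 'M[C]_N :=
  \matrix_(i < N, j < N) (if i == j then (-1) ^+ f i else 0).

Definition S_0 (N : nat) : 'M[C]_N :=
  \matrix_(i < N, j < N)
     (if i == j then (if (i : nat) == 0%N then -1 else 1) else 0).

Definition Qop (N : nat) (A : 'M[C]_N) (f : 'I_N -> bool) : 'M[C]_N :=
  - (A *m S_0 N *m invmx A *m S_f f).

(* A state of the two-register system C^M (x) C^N is represented as an
   M x N matrix s, with s j y the amplitude of |j>|y>. *)

Definition apply_first (M N : nat) (U : 'M[C]_M) (s : 'M[C]_(M, N)) : 'M[C]_(M, N) :=
  U *m s.

(* Lambda_M(U) : |j>|y> |-> |j> (U^j |y>) *)
Definition Lambda (M N : nat) (U : 'M[C]_N) (s : 'M[C]_(M, N)) : 'M[C]_(M, N) :=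
  \matrix_(j < M, y < N) (((U ^+ j) *m (row j s)^T) y ord0).

Definition init_state (M N : nat) (A : 'M[C]_N) : 'M[C]_(M, N) :=
  \matrix_(j < M, y < N) (ket0 M j ord0 * (A *m ket0 N) y ord0).

Definition est_amp_state (M N : nat) (A : 'M[C]_N) (f : 'I_N -> bool)
  : 'M[C]_(M, N) :=
  apply_first (invmx (QFT M))
    (Lambda (Qop A f) (apply_first (QFT M) (init_state M A))).

Definition est_amp_prob (M N : nat) (A : 'M[C]_N) (f : 'I_N -> bool) (y : 'I_M)
  : R := \sum_(x < N) sqnorm (est_amp_state M A f y x).

Definition est_amp_out (M : nat) (y : 'I_M) : R := sin (pi * y%:R / M%:R) ^+ 2.

Definition count_out (N M : nat) (y : 'I_M) : R := N%:R * est_amp_out y.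

Definition count_prob (N M : nat) (f : 'I_N -> bool) (P : R -> bool) : R :=
  \sum_(y < M | P (count_out N y)) est_amp_prob (QFT N) f y.

End QC.

(* Main.v *)
Require Import Defs.
From HB Require Import structures.
From mathcomp Require Import all_boot all_order all_algebra.
From mathcomp Require Import complex.
From mathcomp Require Import reals trigo.
From mathcomp Require Import topology normedtype derive.
From mathcomp Require Import ring lra zify.
Import Order.TTheory GRing.Theory Num.Theory.
Import numFieldNormedType.Exports.
Local Open Scope ring_scope.

(** Put [t / N = sin^2 theta].  The operator [Q] rotates the plane spanned by
the normalized uniform superpositions of the solutions and of the
non-solutions by [2 theta], so the state before the inverse Fourier transform
has amplitudes [sin ((2j+1) theta)] and [cos ((2j+1) theta)].  Combining them
into [exp (+- i (2j+1) theta)], the parallelogram identity gives that [y] is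
observed with probability [(F (y - x) + F (y + x)) / 2], where
[x = M theta / pi] and [F m = sin^2 (pi m) / (M^2 sin^2 (pi m / M))] is the
[M]-periodic kernel of the discrete Fourier transform.  If [y] is within [k]
of [x] or of [-x] modulo [M], then the output meets the error bound.  So it
remains to bound the sum of [F] over a window of half-width [k] around any
real point.  For [k = 1] this follows from
[sin^2 (pi e) (1 / e^2 + 1 / (1 - e)^2) >= 8], applied to the two nearest
integers; for [k >= 2], [F] sums to [1] over a period and its tails are
dominated by [1 / (4 m^2)], whose sum telescopes. *)

(** * Elementary bounds for sine, cosine and [pi] *)

Section Trigonometry.
Set Implicit Arguments. Unset Strict Implicit.
Variable R : realType.
Implicit Types x a b e : R.
Local Notation pi := (pi : R).

Lemma sin_MVT a b : a <= b ->
  exists2 c, a <= c <= b & sin b - sin a = cos c * (b - a).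
Proof.
move=> ab; have [|c cab ->] := @MVT_segment R sin cos a b ab (fun x _ => is_derive_sin x).
  by apply: continuous_subspaceT => x; exact: continuous_sin.
by exists c => //; move: cab; rewrite in_itv.
Qed.

Lemma sin_le x : 0 <= x -> sin x <= x.
Proof.
move=> x0; have [c _] := sin_MVT x0; rewrite sin0 !subr0 => ->.
by rewrite ler_piMl // cos_le1.
Qed.

Lemma sqr_sin_le x : sin x ^+ 2 <= x ^+ 2.
Proof.
wlog x0 : x / 0 <= x => [H|].
  have [/H //|x0] := leP 0 x.
  by rewrite -sqrrN -sinN -(sqrrN x); apply: H; rewrite oppr_ge0 ltW.
have := sin_geN1 x; have := sin_le x0; have [/ltW x1|x1] := ltP 1 x.
  by move=> _ _; rewrite (le_trans (_ : _ <= 1)) ?sqr_ge0 //;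
     [have := cos2Dsin2 x; nra | nra].
have s0 : 0 <= sin x by apply: sin_ge0_pi; have := @pi_ge2 R; lra.
by move=> sx _; rewrite lerXn2r ?nnegrE.
Qed.

(** By [cos x = 1 - 2 sin^2 (x / 2)] and [sin^2 y <= y^2]. *)
Lemma cos_ge_parabola x : 1 - x ^+ 2 / 2 <= cos x.
Proof.
have := sqr_sin_le (x / 2); have := cos2sin2 (x / 2).
have -> : cos x = cos (x / 2) ^+ 2 *+ 2 - 1.
  by rewrite -cos_mulr2n; congr cos; field.
by move=> -> h; lra.
Qed.

Lemma le_cos x a : 0 <= x -> x <= a -> a <= pi -> cos a <= cos x.
Proof.
move=> x0 xa api; rewrite leNgt ltr_cos ?in_itv /=; first by rewrite -leNgt.
all: lra.
Qed.

(* Concavity: the slope of [sin] over [[0, x]] is at least its slope over [[x, b]]. *)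
Lemma sin_chord x b : 0 <= x -> x <= b -> b <= pi -> x * sin b <= b * sin x.
Proof.
move=> x0 xb bpi; have [c1 c1x] := sin_MVT x0.
have [c2 c2x] := sin_MVT xb; rewrite sin0 !subr0 => e2 e1.
have cc : cos c2 <= cos c1 by apply: le_cos; lra.
have -> : sin b = sin x + cos c2 * (b - x) by rewrite -e2; ring.
have : cos c2 * (x * (b - x)) <= cos c1 * (x * (b - x)).
  by rewrite ler_wpM2r // mulr_ge0 //; lra.
by rewrite e1; nra.
Qed.

Lemma mul_cos_le_sin x : 0 <= x -> x <= pi -> x * cos x <= sin x.
Proof.
move=> x0 xpi; have [c cx] := sin_MVT x0; rewrite sin0 !subr0 => ->.
by rewrite mulrC ler_wpM2r // le_cos //; lra.
Qed.

Lemma sqr_sin_piquarter : sin (pi / 4) ^+ 2 = 1 / 2.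
Proof.
have := cos_pihalf R; have -> : pi / 2 = (pi / 4) *+ 2 by field.
by rewrite cos_mulr2n cos2sin2; lra.
Qed.

(** From [sin^2 y <= y^2] at [y = pi / 4]. It makes [8 / pi^2] at most [1], the total mass of the
    kernel. *)
Lemma sqr_pi_ge : 8 <= pi ^+ 2.
Proof. by have := sqr_sin_le (pi / 4); rewrite sqr_sin_piquarter; lra. Qed.

Lemma sin_pisixth : sin (pi / 6) = 1 / 2.
Proof.
have pi0 := @pi_gt0 R.
have s0 : 0 < sin (pi / 6) by apply: sin_gt0_pi; lra.
have : sin (pi / 6 *+ 2 + pi / 6) = 1.
  have -> : pi / 6 *+ 2 + pi / 6 = pi / 2 by field.
  by rewrite sin_pihalf.
rewrite sinD sin_mulr2n cos_mulr2n.
have := cos2Dsin2 (pi / 6); set s := sin _ in s0 *; set c := cos _ => cs.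
have -> : (c * s) *+ 2 * c + (c ^+ 2 *+ 2 - 1) * s = s * (4 * c ^+ 2 - 1) by ring.
have -> : c ^+ 2 = 1 - s ^+ 2 by lra.
(* The triple angle formula gives [3 s - 4 s^3 = 1], which factors in this way; positivity of [s]
   excludes the root [-1]. *)
move=> e; have : (2 * s - 1) ^+ 2 * (s + 1) = 0 by lra.
by move=> /eqP; rewrite mulf_eq0 sqrf_eq0 => /orP[] /eqP; lra.
Qed.

(* From [x cos x <= sin x] at [x = pi / 12]; [pi / 8] would not be sharp enough for
   [sqr_sin_two_points]. *)
Lemma sqr_pi_le : pi ^+ 2 <= 52 / 5.
Proof.
have pi0 := @pi_gt0 R.
have c6 : cos (pi / 6) ^+ 2 = 3 / 4 by rewrite cos2sin2 sin_pisixth; field.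
have c6p : 0 < cos (pi / 6) by apply: cos_gt0_pihalf; lra.
(* A rational lower bound for [sqrt 3 / 2]. *)
have c6l : 433 / 500 <= cos (pi / 6) by nra.
have := cos_mulr2n (pi / 12); have -> : pi / 12 *+ 2 = pi / 6 by field.
rewrite cos2sin2 => e.
have := @mul_cos_le_sin (pi / 12); have c12 : 0 < cos (pi / 12) by apply: cos_gt0_pihalf; lra.
move=> /(_ ltac:(lra) ltac:(lra)) h.
have : (pi / 12 * cos (pi / 12)) ^+ 2 <= sin (pi / 12) ^+ 2.
  have xc0 : 0 <= pi / 12 * cos (pi / 12) by rewrite mulr_ge0 //; lra.
  by rewrite lerXn2r ?nnegrE //; apply: le_trans h.
rewrite exprMn cos2sin2; set s := sin (pi / 12) ^+ 2 in e *.
have s1 : s <= 67 / 1000 by lra.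
have p2 : 0 <= pi ^+ 2 by exact: sqr_ge0.
by move: p2; rewrite expr_div_n; nra.
Qed.

Lemma sqr_sin_two_points e : 0 < e -> e < 1 ->
  8 <= sin (pi * e) ^+ 2 * (1 / e ^+ 2 + 1 / (1 - e) ^+ 2).
Proof.
have pi0 := @pi_gt0 R.
(* The right-hand side is invariant under [e -> 1 - e]. *)
wlog e2 : e / e <= 1 / 2 => [H e0 e1|e0 _].
  have [/H -> //|e2] := leP e (1 / 2).
  have := H (1 - e) ltac:(lra) ltac:(lra) ltac:(lra).
  have -> : 1 - (1 - e) = e by ring.
  have -> : sin (pi * (1 - e)) = sin (pi * e).
    by rewrite mulrBr mulr1 sinB sinpi cospi; ring.
  by rewrite [X in _ * X]addrC.
have d0 : 0 < e ^+ 2 by rewrite exprn_gt0.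
have d1 : 0 < (1 - e) ^+ 2 by rewrite exprn_gt0 //; lra.
have [e4|e4] := leP e (1 / 4).
  (* By the chord bound up to [pi / 4], already [sin^2 (pi e) / e^2 >= 8]. *)
  have h := @sin_chord (pi * e) (pi / 4) ltac:(nra) ltac:(nra) ltac:(lra).
  have {}h : 4 * e * sin (pi / 4) <= sin (pi * e) by nra.
  have s4 : 0 < sin (pi / 4) by apply: sin_gt0_pi; lra.
  have : (4 * e * sin (pi / 4)) ^+ 2 <= sin (pi * e) ^+ 2.
    by rewrite lerXn2r ?nnegrE //; [nra|apply: le_trans h; nra].
  rewrite exprMn sqr_sin_piquarter => {}h.
  have k1 : 8 <= sin (pi * e) ^+ 2 * (1 / e ^+ 2) by rewrite mul1r ler_pdivlMr //; lra.
  rewrite mulrDr (le_trans k1) // lerDl mulr_ge0 ?sqr_ge0 //.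
  by rewrite divr_ge0 // ltW.
(* Equality holds at [e = 1 / 2], so expand there. *)
pose u := 1 / 2 - e; have sc : sin (pi * e) = cos (pi * u).
  have -> : pi * e = - (pi * u) + pi / 2 by rewrite /u; field.
  by rewrite sinDpihalf cosN.
have := cos_ge_parabola (pi * u); rewrite -sc exprMn => h.
have hp := sqr_pi_le; have u4 : u < 1 / 4 by rewrite /u; lra.
have u0 : 0 <= u by rewrite /u; lra.
have q0 : 0 <= u ^+ 2 by exact: sqr_ge0.
have q1 : u ^+ 2 <= 1 / 16 by nra.
have {}h : 1 - 26 / 5 * u ^+ 2 <= sin (pi * e) by nra.
have : (1 - 26 / 5 * u ^+ 2) ^+ 2 <= sin (pi * e) ^+ 2.
  by rewrite lerXn2r ?nnegrE //; [lra|apply: le_trans h; lra].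
have -> : 1 / e ^+ 2 + 1 / (1 - e) ^+ 2 =
   (1 / 2 + 2 * u ^+ 2) / (1 / 4 - u ^+ 2) ^+ 2.
  by rewrite /u; field; rewrite !gt_eqF //; nra.
have dd : 0 < (1 / 4 - u ^+ 2) ^+ 2 by rewrite exprn_gt0 //; lra.
move=> {}h; rewrite mulrA ler_pdivlMr //.
move: h q0 q1; set q := u ^+ 2; set S := sin _ ^+ 2 => h q0 q1.
have : (1 - 26 / 5 * q) ^+ 2 * (1 / 2 + 2 * q) <= S * (1 / 2 + 2 * q).
  by rewrite ler_wpM2r //; lra.
apply: le_trans.
(* This product is the difference of the two sides still to be compared. The smaller root of the
   quadratic lies just above [1 / 16], the upper bound on [q]. *)
have : 0 <= q * (4 / 5 - 1528 / 100 * q + 5408 / 100 * q ^+ 2).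
  by rewrite mulr_ge0 //; nra.
by lra.
Qed.

(** Expand [sin (a + d)] exactly, then use [|sin d| <= |d|] and [|cos 2a| <= 1]. The two terms
    become the two terms of the error bound of the theorem. *)
Lemma sqr_sin_perturb a d :
  `|sin (a + d) ^+ 2 - sin a ^+ 2| <= 2 * `|d| * `|sin a * cos a| + d ^+ 2.
Proof.
have -> : sin (a + d) ^+ 2 - sin a ^+ 2 =
   2 * (sin d * cos d) * (sin a * cos a) + sin d ^+ 2 * (cos a ^+ 2 - sin a ^+ 2).
  by rewrite sinD [in LHS]sqrrD !exprMn [cos d ^+ 2]cos2sin2; ring.
have sd : `|sin d| <= `|d| by rewrite -ler_sqr ?nnegrE // !real_normK ?num_real // sqr_sin_le.
apply: le_trans (ler_normD _ _) _; apply: lerD.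
  rewrite normrM ler_wpM2r // normrM ger0_norm // ler_wpM2l // normrM.
  by rewrite (le_trans _ sd) // ler_piMr // cos_max.
rewrite normrM ger0_norm ?sqr_ge0 //.
apply: le_trans (sqr_sin_le d); rewrite ler_piMr ?sqr_ge0 // ler_norml.
by have := cos2Dsin2 a; have := sqr_ge0 (cos a); have := sqr_ge0 (sin a); lra.
Qed.

End Trigonometry.

(** * Complex phases and squared moduli *)

Section Phases.
Set Implicit Arguments. Unset Strict Implicit.
Variable R : realType.
Implicit Types a b x : R.
Implicit Types z w : R[i].
Local Notation pi := (pi : R).
Local Open Scope complex_scope.

Lemma expiD a b : expi (a + b) = expi a * expi b.
Proof. by rewrite /expi sinD cosD; simpc; congr Complex; ring. Qed.

Lemma expi0 : expi 0 = 1 :> R[i].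
Proof. by rewrite /expi sin0 cos0. Qed.

Lemma expiN a : expi (- a) = (expi a)^*.
Proof. by rewrite /expi sinN cosN. Qed.

Lemma conjc_real_expi a b : (a%:C * expi b)^* = a%:C * expi (- b).
Proof. by rewrite expiN; rewrite /expi; simpc. Qed.

Lemma expi_mulrn a n : expi (a *+ n) = expi a ^+ n.
Proof. by elim: n => [|n IH]; rewrite ?expi0 // mulrS exprS expiD IH. Qed.

Lemma expi_2pi_nat n : expi (2 * pi * n%:R) = 1.
Proof.
have -> : 2 * pi * n%:R = pi *+ 2 *+ n by rewrite -(mulr_natr (pi *+ 2)); ring.
by rewrite expi_mulrn /expi cos2pi sin2pi expr1n.
Qed.

Lemma sqnorm_ge0 z : 0 <= sqnorm z.
Proof. by rewrite addr_ge0 ?sqr_ge0. Qed.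

Lemma sqnormM z w : sqnorm (z * w) = sqnorm z * sqnorm w.
Proof. by case: z w => [a b] [c d]; rewrite /sqnorm /=; ring. Qed.

Lemma sqnorm_real a : sqnorm a%:C = a ^+ 2.
Proof. by rewrite /sqnorm /= expr0n addr0. Qed.

Lemma sqnorm_expi a : sqnorm (expi a) = 1.
Proof. exact: cos2Dsin2. Qed.

Lemma sqnorm_mul_conj z : (sqnorm z)%:C = z^* * z.
Proof. by case: z => a b; rewrite /sqnorm; simpc; congr Complex; ring. Qed.

Lemma sqnorm_oneB_expi a : sqnorm (1 - expi a) = 4 * sin (a / 2) ^+ 2.
Proof.
have e : a / 2 *+ 2 = a by field.
rewrite /sqnorm /= -{1 2}e cos_mulr2n sin_mulr2n.
have := cos2Dsin2 (a / 2); move: (cos _) (sin _) => c s cs.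
have -> : c ^+ 2 = 1 - s ^+ 2 by lra.
have -> : (0 - c * s *+ 2) ^+ 2 = 4 * s ^+ 2 * c ^+ 2 by ring.
have -> : c ^+ 2 = 1 - s ^+ 2 by lra.
by ring.
Qed.

(** Serves to replace amplitudes built on cosines and sines, [z] and [w], by the sums of pure phases
    [z + i w] and [z - i w]. *)
Lemma sqnorm_parallelogram (z w : R[i]) :
  sqnorm (z + 'i * w) + sqnorm (z - 'i * w) = 2 * (sqnorm z + sqnorm w).
Proof. by case: z w => [a b] [c d]; rewrite /sqnorm /=; ring. Qed.

Lemma geometric_sum w n : (1 - w) * (\sum_(j < n) w ^+ j) = 1 - w ^+ n.
Proof. by rewrite -opprB mulNr -subrX1 opprB. Qed.

End Phases.

(** * The kernel of the discrete Fourier transform *)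

Section FejerKernel.
Set Implicit Arguments. Unset Strict Implicit.
Variables (R : realType) (M : nat).
Hypothesis M_gt0 : (0 < M)%N.
Implicit Types m z : R.
Local Notation pi := (pi : R).
Local Notation C := R[i].
Local Open Scope complex_scope.

Let MR_gt0 : 0 < M%:R :> R. Proof. by rewrite ltr0n. Qed.
Let MR_neq0 : M%:R != 0 :> R. Proof. by rewrite gt_eqF. Qed.

(** Given by the exponential sum rather than by the quotient of sines, which is [0 / 0] at multiples
    of [M]. *)
Definition fejer (m : R) : R :=
  sqnorm ((M%:R^-1)%:C * \sum_(j < M) expi (- (2 * pi * (j%:R * m) / M%:R))).

Lemma fejer_ge0 m : 0 <= fejer m.
Proof. exact: sqnorm_ge0. Qed.

Lemma fejerDM m : fejer (m + M%:R) = fejer m.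
Proof.
congr (sqnorm (_ * _)); apply: eq_bigr => j _.
have -> : - (2 * pi * (j%:R * (m + M%:R)) / M%:R) =
   - (2 * pi * (j%:R * m) / M%:R) + - (2 * pi * j%:R) by field.
by rewrite expiD (expiN (_ * j%:R)) expi_2pi_nat conjc1 mulr1.
Qed.

Lemma fejer0 : fejer 0 = 1.
Proof.
rewrite /fejer (eq_bigr (fun _ => 1)) => [|j _]; last first.
  by rewrite !mulr0 mul0r oppr0 expi0.
rewrite sumr_const card_ord -(rmorph_nat (real_complex R)) -rmorphM /=.
by rewrite sqnorm_real mulVf // expr1n.
Qed.

(** Sum the geometric series with ratio [w] and take squared moduli. The product form remains valid
    where the sine on the left vanishes. *)
Lemma fejer_sin m :
  fejer m * (M%:R * sin (pi * m / M%:R)) ^+ 2 = sin (pi * m) ^+ 2.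
Proof.
set w := expi (- (2 * pi * m / M%:R)).
have geo : (M%:R^-1)%:C * (\sum_(j < M) expi (- (2 * pi * (j%:R * m) / M%:R)))
   * (M%:R%:C * (1 - w)) = 1 - expi (- (2 * pi * m)).
  have -> : expi (- (2 * pi * m)) = w ^+ M.
    by rewrite -expi_mulrn; congr expi; rewrite -mulr_natr; field.
  rewrite -(geometric_sum w) -[RHS]mulr1.
  have <- : (M%:R^-1)%:C * M%:R%:C = 1 :> C by rewrite -rmorphM /= mulVf.
  under eq_bigr => j _.
    have -> : expi (- (2 * pi * (j%:R * m) / M%:R)) = w ^+ j.
      by rewrite -expi_mulrn; congr expi; rewrite -mulr_natr; field.
  over.
  by ring.
have := congr1 (@sqnorm R) geo.
rewrite sqnormM -/(fejer m) sqnormM sqnorm_real !sqnorm_oneB_expi.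
have -> : - (2 * pi * m / M%:R) / 2 = - (pi * m / M%:R) by field.
have -> : - (2 * pi * m) / 2 = - (pi * m) by field.
rewrite !sinN !sqrrN => h.
by apply: (@mulfI _ (4 : R)); rewrite ?pnatr_eq0 // -h; ring.
Qed.

Lemma fejer_int n : (0 < n < M)%N -> fejer n%:R = 0.
Proof.
move=> /andP[n0 nM]; have := fejer_sin n%:R.
have -> : sin (pi * n%:R) = 0.
  (* [|1 - exp (2 pi i n)|^2 = 4 sin^2 (pi n)], and the left side is zero. *)
  have := sqnorm_oneB_expi (2 * pi * n%:R : R); rewrite expi_2pi_nat subrr.
  have -> : 2 * pi * n%:R / 2 = pi * n%:R by field.
  by rewrite /sqnorm /= expr0n addr0 => /esym/eqP; rewrite mulf_eq0 sqrf_eq0 pnatr_eq0 => /eqP.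
rewrite expr0n => /eqP; rewrite mulf_eq0 sqrf_eq0 mulf_eq0 (negPf MR_neq0) /=.
case/orP => [/eqP //|]; rewrite gt_eqF //; apply: sin_gt0_pi.
have pi0 := pi_gt0 R; rewrite divr_gt0 ?mulr_gt0 ?ltr0n //=.
by rewrite ltr_pdivrMr // ltr_pM2l // ltr_nat.
Qed.

Lemma sqr_sin_le_fejer m : sin (pi * m) ^+ 2 <= fejer m * (pi * m) ^+ 2.
Proof.
rewrite -fejer_sin ler_wpM2l ?fejer_ge0 // exprMn.
have -> : (pi * m) ^+ 2 = M%:R ^+ 2 * (pi * m / M%:R) ^+ 2 by field.
by apply: ler_wpM2l; rewrite ?exprn_ge0 ?sqr_sin_le ?ltW.
Qed.

(* Keeping both terms avoids finding the representative of [m] modulo [M] nearest to [0]. *)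
Lemma fejer_le m : 0 < m -> m < M%:R ->
  fejer m <= (1 / m ^+ 2 + 1 / (M%:R - m) ^+ 2) / 4.
Proof.
have pi0 := pi_gt0 R.
have half (x : R) : 0 < x -> x <= M%:R / 2 ->
    fejer m * (M%:R * sin (pi * x / M%:R)) ^+ 2 <= 1 -> fejer m <= 1 / x ^+ 2 / 4.
  move=> x0 xM h.
  rewrite -mulrA -invfM mul1r -[leRHS]mul1r ler_pdivlMr; last first.
    by rewrite mulr_gt0 // exprn_gt0.
  apply: le_trans h; rewrite ler_wpM2l ?fejer_ge0 //.
  have -> : x ^+ 2 * 4 = (2 * x) ^+ 2 by ring.
  have b0 : 0 <= pi * x / M%:R by rewrite divr_ge0 ?mulr_ge0 // ltW.
  have b1 : pi * x / M%:R <= pi / 2 by rewrite ler_pdivrMr //; nra.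
  have := sin_chord b0 b1 ltac:(lra); rewrite sin_pihalf mulr1.
  rewrite ler_pdivrMr // => h; have {}h : 2 * x <= M%:R * sin (pi * x / M%:R) by nra.
  by rewrite lerXn2r ?nnegrE //; [lra | apply: le_trans h; lra].
move=> m0 mM; have s1 : sin (pi * m) ^+ 2 <= 1.
  by have := cos2Dsin2 (pi * m); have := sqr_ge0 (cos (pi * m)); lra.
rewrite mulrDl; have [mM2|mM2] := leP m (M%:R / 2).
  apply: le_trans (half m m0 mM2 _) _; first by rewrite fejer_sin.
  by rewrite lerDl ?divr_ge0 ?sqr_ge0.
apply: le_trans (half (M%:R - m) _ _ _) _; [lra|lra| |].
  have -> : pi * (M%:R - m) / M%:R = pi - pi * m / M%:R by field.
  have -> : sin (pi - pi * m / M%:R) = sin (pi * m / M%:R) by rewrite sinB sinpi cospi; ring.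
  by rewrite fejer_sin.
by rewrite lerDr ?divr_ge0 ?sqr_ge0.
Qed.

(** * The inverse Fourier transform and Parseval's identity *)

Definition dft_conj : 'M[C]_M :=
  \matrix_(y < M, x < M)
     ((Num.sqrt (M%:R : R))^-1 %:C * expi (- (2 * pi * (x%:R * y%:R) / M%:R))).

Let root_neq1 n : (0 < n < M)%N -> 1 - expi (2 * pi * n%:R / M%:R) != 0 :> C.
Proof.
move=> /andP[n0 nM]; apply/eqP => /(congr1 (@sqnorm R)).
rewrite sqnorm_oneB_expi sqnorm_real expr0n => /eqP.
rewrite mulf_eq0 pnatr_eq0 sqrf_eq0 /= gt_eqF //; have pi0 := pi_gt0 R.
have -> : 2 * pi * n%:R / M%:R / 2 = pi * n%:R / M%:R by field.
apply: sin_gt0_pi; rewrite divr_gt0 ?mulr_gt0 ?ltr0n //=.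
by rewrite ltr_pdivrMr // ltr_pM2l // ltr_nat.
Qed.

Lemma sum_roots_of_unity n : (0 < n < M)%N ->
  \sum_(y < M) expi (2 * pi * (n%:R * y%:R) / M%:R) = 0 :> C.
Proof.
move=> nM; apply: (mulfI (root_neq1 nM)); rewrite mulr0.
under eq_bigr => y _.
  have -> : expi (2 * pi * (n%:R * y%:R) / M%:R) = expi (2 * pi * n%:R / M%:R) ^+ y :> C.
    by rewrite -expi_mulrn; congr expi; rewrite -mulr_natr; field.
over.
rewrite geometric_sum -expi_mulrn.
have -> : 2 * pi * n%:R / M%:R *+ M = 2 * pi * n%:R :> R by rewrite -mulr_natr; field.
by rewrite expi_2pi_nat subrr.
Qed.

Lemma QFT_dft_conj : QFT R M *m dft_conj = 1%:M.
Proof.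
apply/matrixP => i j; rewrite !mxE.
under eq_bigr => y _.
  rewrite !mxE mulrACA -expiD.
  have -> : 2 * pi * (y%:R * i%:R) / M%:R - 2 * pi * (j%:R * y%:R) / M%:R =
     2 * pi * ((i%:R - j%:R) * y%:R) / M%:R :> R by field.
over.
rewrite -mulr_sumr -rmorphM /= -invfM -expr2 sqr_sqrtr ?ltW //.
have [<-|] := eqVneq i j.
  under eq_bigr do rewrite subrr mul0r mulr0 mul0r expi0.
  by rewrite sumr_const card_ord -(rmorph_nat (real_complex R)) -rmorphM /= mulVf.
move=> ij; rewrite mulr0n; suff -> : \sum_(y < M) expi (2 * pi * ((i%:R - j%:R) * y%:R) / M%:R) = 0.
  by rewrite mulr0.
(* The sum for [i < j] is the conjugate of the one with the indices exchanged, so a positive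
   exponent suffices. *)
wlog lt_ji : i j ij / (j < i)%N => [H|].
  have [|] := ltnP j i; first exact: H.
  rewrite leq_eqVlt => /predU1P[/val_inj e|lt_ij]; first by rewrite e eqxx in ij.
  rewrite eq_sym in ij; have := congr1 conjc (H j i ij lt_ij).
  rewrite rmorph_sum conjc0 => e; rewrite -[RHS]e; apply: eq_bigr => y _.
  apply: etrans (expiN _); congr expi; field.
  exact: MR_neq0.
rewrite -natrB 1?ltnW // sum_roots_of_unity // subn_gt0 lt_ji /=.
by rewrite (leq_ltn_trans (leq_subr _ _)).
Qed.

Lemma invmx_QFT : invmx (QFT R M) = dft_conj.
Proof.
have [u _] := mulmx1_unit QFT_dft_conj.
by rewrite -[LHS]mulmx1 -QFT_dft_conj mulKmx.
Qed.

(** The matrix is symmetric, so its conjugate transpose is [QFT R M], which cancels it inside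
    [v^* v]. *)
Lemma dft_conj_isometry (v : 'cV[C]_M) :
  \sum_(y < M) sqnorm ((dft_conj *m v) y ord0) = \sum_(j < M) sqnorm (v j ord0).
Proof.
have sqE (w : 'cV[C]_M) : (\sum_y sqnorm (w y ord0))%:C = ((map_mx conjc w)^T *m w) ord0 ord0.
  rewrite rmorph_sum /= !mxE; apply: eq_bigr => y _.
  by rewrite sqnorm_mul_conj !mxE.
apply: complexI; rewrite !sqE map_mxM trmx_mul.
have -> : (map_mx conjc dft_conj)^T = QFT R M.
  apply/matrixP => i j; rewrite !mxE conjc_real_expi opprK.
  by rewrite [i%:R * _]mulrC.
by rewrite -mulmxA (mulmxA (QFT R M)) QFT_dft_conj mul1mx.
Qed.

(** Parseval: the summand is the squared modulus of the [y]-th coordinate of the transform of [v], a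
    unit vector of phases. *)
Lemma sum_fejer z : \sum_(y < M) fejer (y%:R + z) = 1.
Proof.
pose v : 'cV[C]_M := \col_j ((Num.sqrt (M%:R : R))^-1 %:C * expi (- (2 * pi * (j%:R * z) / M%:R))).
transitivity (\sum_(y < M) sqnorm ((dft_conj *m v) y ord0)).
  apply: eq_bigr => y _; congr sqnorm; rewrite mxE mulr_sumr.
  apply: eq_bigr => j _; rewrite !mxE [RHS]mulrACA -expiD -rmorphM /=.
  rewrite -invfM -expr2 sqr_sqrtr ?ltW //; congr (_ * expi _).
  by field.
rewrite dft_conj_isometry (eq_bigr (fun _ => M%:R^-1)) => [|j _].
  by rewrite sumr_const card_ord -(mulr_natr M%:R^-1) mulVf.
by rewrite mxE sqnormM sqnorm_expi mulr1 sqnorm_real exprVn sqr_sqrtr // ltW.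
Qed.

(** * Sums over a period, and tails of inverse squares *)

Lemma sum_periodic_shift (G : R -> R) z : (forall m, G (m + M%:R) = G m) ->
  \sum_(y < M) G (y%:R + (z + 1)) = \sum_(y < M) G (y%:R + z).
Proof.
move=> GM; case: M M_gt0 GM => // n _ GM.
(* The last term on the left is the first one on the right, one period later. *)
rewrite big_ord_recr [RHS]big_ord_recl /= addrC; congr (_ + _).
  by rewrite -[RHS]GM; congr G; rewrite -natr1; ring.
by apply: eq_bigr => i _; congr G; rewrite /bump /= add1n -natr1; ring.
Qed.

Lemma sum_periodic_floor (G : R -> R) z : (forall m, G (m + M%:R) = G m) ->
  exists2 e, 0 <= e < 1 & \sum_(y < M) G (y%:R + z) = \sum_(y < M) G (y%:R + e).
Proof.
move=> GM; have S n x : \sum_(y < M) G (y%:R + (x + n%:R)) = \sum_(y < M) G (y%:R + x).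
  elim: n => [|n IH]; first by rewrite addr0.
  by rewrite -natr1 addrA sum_periodic_shift.
exists (z - (Num.floor z)%:~R); first by have /andP[] := floor_itv z; rewrite intrD; lra.
case: (Num.floor z) => n; first by rewrite -[RHS](S n) subrK.
by rewrite NegzE rmorphN opprK S.
Qed.

Lemma sum_inv_sqr_le k n : (2 <= k)%N ->
  \sum_(k <= j < k + n) 1 / (j%:R : R) ^+ 2 <= (k%:R - 1)^-1 - (k%:R + n%:R - 1)^-1.
Proof.
move=> k2; have kR : 2 <= k%:R :> R by rewrite ler_nat.
elim: n => [|n IH]; first by rewrite addn0 big_geq // addr0 subrr.
rewrite addnS big_nat_recr ?leq_addr //= -natr1 natrD.
apply: le_trans (lerD IH (lexx _)) _; have n0 : 0 <= n%:R :> R by exact: ler0n.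
move: (k%:R) kR IH => x x2 _; move: (n%:R) n0 => y y0.
rewrite -subr_ge0; set d := (X in 0 <= X).
(* The slack of the telescoping bound [1 / s^2 <= 1 / (s - 1) - 1 / s] at [s = x + y]. *)
have -> : d = ((x + y) ^+ 2 * (x + y - 1))^-1.
  by rewrite /d; field; rewrite !gt_eqF //; lra.
by rewrite invr_ge0 mulr_ge0 ?exprn_ge0 //; lra.
Qed.

(** Strict because the telescoped bound still subtracts the positive [1 / (M - 1)]; for [M <= k] the
    sum is empty. *)
Lemma sum_inv_sqr_tail k : (2 <= k)%N ->
  \sum_(j < M | (k <= j)%N) 1 / (j%:R : R) ^+ 2 < (k%:R - 1)^-1.
Proof.
move=> k2; have kR : 2 <= k%:R :> R by rewrite ler_nat.
have [Mk|kM] := leqP M k.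
  rewrite big_pred0 ?invr_gt0 => [|i]; first by lra.
  by apply/negbTE; rewrite -ltnNge (leq_trans (ltn_ord i)).
rewrite -(big_mkord (fun j => k <= j)%N (fun j => 1 / (j%:R : R) ^+ 2)).
have <- := big_nat_widenl k 0 M xpredT (fun j => 1 / (j%:R : R) ^+ 2) (leq0n k).
rewrite -(subnKC (ltnW kM)).
apply: le_lt_trans (sum_inv_sqr_le _ k2) _.
rewrite ltrBlDr ltrDl invr_gt0 -natrD subnKC ?(ltnW kM) // subr_gt0 ltr1n.
by rewrite (leq_trans k2 (ltnW kM)).
Qed.

(** * Kernel mass on the outcomes that satisfy a periodic predicate *)

Section Window.
Variables (k : nat) (P : R -> bool).
Hypothesis PM : forall m, P (m + M%:R) = P m.
Hypothesis Pk : forall m, `|m| <= k%:R -> P m.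

(** Cutting off by zero, instead of restricting the indices, leaves an [M]-periodic function, so the
    whole sum can be shifted by integers. *)
Let G m := if P m then fejer m else 0.

Let G_ge0 m : 0 <= G m.
Proof. by rewrite /G; case: ifP; rewrite ?fejer_ge0. Qed.

Let G_fejer m : P m -> G m = fejer m.
Proof. by rewrite /G => ->. Qed.

Let fejer_window_reduce z : exists2 e, 0 <= e < 1 &
  \sum_(y < M | P (y%:R + z)) fejer (y%:R + z) = \sum_(y < M) G (y%:R + e).
Proof.
have [|e e01 ee] := @sum_periodic_floor G z.
  by move=> m; rewrite /G PM fejerDM.
by exists e; rewrite // -ee big_mkcond.
Qed.

Let sum_G_ge1 : 1 <= \sum_(y < M) G (y%:R + 0).
Proof.
rewrite (bigD1 (Ordinal M_gt0)) //= addr0 G_fejer ?fejer0 ?Pk ?normr0 //.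
by rewrite lerDl sumr_ge0.
Qed.

Lemma fejer_window_ge z : (0 < k)%N ->
  8 / pi ^+ 2 <= \sum_(y < M | P (y%:R + z)) fejer (y%:R + z).
Proof.
move=> k0; have [e /andP[e0 e1] ->] := fejer_window_reduce z.
have kR : 1 <= k%:R :> R by rewrite ler1n.
have pi2 : 0 < pi ^+ 2 by rewrite exprn_gt0 ?pi_gt0.
have le1 : 8 / pi ^+ 2 <= 1 by rewrite ler_pdivrMr // mul1r sqr_pi_ge.
have [->|e_neq0] := eqVneq e 0; first exact: le_trans sum_G_ge1.
have {}e0 : 0 < e by rewrite lt_neqAle eq_sym e_neq0.
have Pe : P e by rewrite Pk // ger0_norm; lra.
(* With a single outcome the indices [0] and [M.-1] coincide, but the sum is then a full period, of
   mass [1]. *)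
have [M1|M2] := leqP M 1.
  apply: le_trans le1 _; rewrite -[leLHS](sum_fejer e) ler_sum // => y _.
  have -> : y = 0%N :> nat by have := ltn_ord y; lia.
  by rewrite add0r G_fejer.
pose i0 := Ordinal M_gt0; have lt_pM : (M.-1 < M)%N by rewrite prednK.
pose i1 := Ordinal lt_pM; have i10 : i1 != i0 by rewrite -val_eqE /=; lia.
(* Modulo [M] the last index is the left neighbour, at displacement [e - 1]. *)
have mE : M.-1%:R + e = (e - 1) + M%:R by rewrite -{2}(prednK M_gt0) -natr1; ring.
have P1 : P (e - 1) by rewrite Pk // ler0_norm; lra.
rewrite (bigD1 i0) //= (bigD1 i1) //= add0r mE !G_fejer ?PM // fejerDM.
rewrite addrA -[leLHS]addr0 lerD ?sumr_ge0 //.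
have := sqr_sin_two_points e0 e1.
have := sqr_sin_le_fejer e; have := sqr_sin_le_fejer (e - 1).
have -> : sin (pi * (e - 1)) = - sin (pi * e).
  by rewrite mulrBr mulr1 sinB sinpi cospi; ring.
rewrite sqrrN !exprMn; have -> : (e - 1) ^+ 2 = (1 - e) ^+ 2 by ring.
have d0 : 0 < e ^+ 2 by rewrite exprn_gt0.
have d1 : 0 < (1 - e) ^+ 2 by rewrite exprn_gt0 //; lra.
have scale (d F : R) : 0 < d -> sin (pi * e) ^+ 2 <= F * (pi ^+ 2 * d) ->
    sin (pi * e) ^+ 2 * (1 / d) <= F * pi ^+ 2.
  by move=> d_gt0 h; rewrite mul1r ler_pdivrMr // -mulrA.
move=> /(scale _ _ d1) h1 /(scale _ _ d0) h0; rewrite mulrDr => h.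
by rewrite ler_pdivrMr // mulrDl; apply: (le_trans h); rewrite lerD.
Qed.

Lemma fejer_window_gt z : (2 <= k)%N ->
  1 - (2 * (k%:R - 1))^-1 < \sum_(y < M | P (y%:R + z)) fejer (y%:R + z).
Proof.
move=> k2; have [e /andP[e0 e1] ->] := fejer_window_reduce z.
have kR : 2 <= k%:R :> R by rewrite ler_nat.
have [->|e_neq0] := eqVneq e 0.
  by apply: lt_le_trans sum_G_ge1; rewrite gtrBl invr_gt0; lra.
have {}e0 : 0 < e by rewrite lt_neqAle eq_sym e_neq0.
(* Outside the window both [j] and [M - 1 - j] are at least [k]. As [j + e >= j] and
   [M - (j + e) >= M - 1 - j], the two terms of [fejer_le] are bounded by [B j] and
   [B (rev_ord j)]. *)
pose B (j : 'I_M) : R := (if (k <= j)%N then 1 / j%:R ^+ 2 else 0) / 4.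
have B_ge0 j : 0 <= B j by rewrite /B; case: ifP => _; rewrite ?mul0r // !divr_ge0 ?exprn_ge0.
have inv_le (a b : R) : 0 < a -> a <= b -> 1 / b ^+ 2 <= 1 / a ^+ 2.
  move=> a0 ab; rewrite !mul1r lef_pV2 ?posrE ?exprn_gt0 //; last lra.
  by rewrite lerXn2r ?nnegrE //; lra.
have GB (j : 'I_M) : fejer (j%:R + e) <= G (j%:R + e) + (B j + B (rev_ord j)).
  rewrite /G; case: ifPn => [_|nP]; first by rewrite lerDl addr_ge0.
  have jM := ltn_ord j.
  have revE : (rev_ord j)%:R = M%:R - j%:R - 1 :> R by rewrite /= natrB // -natr1; ring.
  have kj : (k <= j)%N.
    rewrite leqNgt; apply: contra nP => jk; rewrite Pk // ger0_norm.
      by move: jk; rewrite -(ler_nat R) -natr1; lra.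
    by rewrite addr_ge0 // ltW.
  have kj' : (k <= rev_ord j)%N.
    rewrite leqNgt; apply: contra nP => jk; rewrite -(subrK M%:R (_ + e)) PM Pk //.
    move: jk (ltn_ord j); rewrite -!(ler_nat R) -!natr1 revE => h1 h2.
    by rewrite ler0_norm; lra.
  have j0 : k%:R <= j%:R :> R by rewrite ler_nat.
  have j0' : k%:R <= M%:R - j%:R - 1 :> R by rewrite -revE ler_nat.
  rewrite add0r /B kj kj' -mulrDl revE; apply: le_trans (fejer_le _ _) _; [lra|lra|].
  by rewrite ler_pM2r ?invr_gt0 // lerD // inv_le //; lra.
have /eqP := sum_fejer e; rewrite eq_le => /andP[_ s1].
have := le_trans s1 (ler_sum _ (fun j _ => GB j)); rewrite !big_split /=.
(* Reversal makes the two tails equal; each is less than [1 / (4 (k - 1))]. *)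
rewrite -(reindex_inj (P := predT) (F := B) rev_ord_inj) /= /B -mulr_suml.
have := sum_inv_sqr_tail k2; rewrite big_mkcond /= invfM.
move: (\sum_(i < M) _) (\sum_(i < M) _) => S T; lra.
Qed.
End Window.
End FejerKernel.

(** * The uniform superposition as the Fourier image of [|0>] *)

Section KetZero.
Set Implicit Arguments. Unset Strict Implicit.
Variables (R : realType) (N : nat).
Hypothesis N_gt0 : (0 < N)%N.
Local Open Scope complex_scope.

Lemma QFT_ket0 : QFT R N *m ket0 R N = const_mx (Num.sqrt N%:R)^-1%:C.
Proof.
apply/matrixP => x j; rewrite !mxE (bigD1 (Ordinal N_gt0)) //= big1 ?addr0 => [|i i0].
  by rewrite !mxE /= mulr1 mul0r mulr0 mul0r expi0 mulr1.
by rewrite !mxE -[_ == 0%N]/(i == Ordinal N_gt0) (negPf i0) mulr0.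
Qed.

Lemma ket0_dft_conj : (ket0 R N)^T *m dft_conj R N = const_mx (Num.sqrt N%:R)^-1%:C.
Proof.
apply/matrixP => x j; rewrite !mxE (bigD1 (Ordinal N_gt0)) //= big1 ?addr0 => [|i i0].
  by rewrite !mxE /= mul1r !mulr0 mul0r oppr0 expi0 mulr1.
by rewrite !mxE -[_ == 0%N]/(i == Ordinal N_gt0) (negPf i0) mul0r.
Qed.

End KetZero.

(** * Grover's rotation in the plane of solutions and non-solutions *)

Section Counting.
Set Implicit Arguments. Unset Strict Implicit.
Variables (R : realType) (N M : nat) (f : 'I_N -> bool).
Hypotheses (N_gt0 : (0 < N)%N) (M_gt0 : (0 < M)%N).
Local Notation pi := (pi : R).
Local Notation C := R[i].
Local Open Scope complex_scope.

Let NR_gt0 : 0 < N%:R :> R. Proof. by rewrite ltr0n. Qed.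
Let NR_neq0 : N%:R != 0 :> R. Proof. by rewrite gt_eqF. Qed.
Let MR_neq0 : M%:R != 0 :> R. Proof. by rewrite pnatr_eq0 -lt0n. Qed.

Let t : nat := #|[pred x | f x]|.
Definition grover_angle : R := asin (Num.sqrt (t%:R / N%:R)).
Local Notation theta := grover_angle.

Let t_le_N : (t <= N)%N.
Proof. by rewrite -[leqRHS]card_ord max_card. Qed.

Let frac_itv : 0 <= (t%:R / N%:R : R) <= 1.
Proof. by rewrite divr_ge0 //= ler_pdivrMr // mul1r ler_nat. Qed.

Let sqrt_itv : -1 <= Num.sqrt (t%:R / N%:R : R) <= 1.
Proof.
have /andP[f0 f1] := frac_itv.
by rewrite (le_trans _ (sqrtr_ge0 _)) ?lerN10 //= -[leRHS]sqrtr1 ler_sqrt.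
Qed.

Lemma sqr_sin_grover_angle : sin theta ^+ 2 = t%:R / N%:R.
Proof.
by rewrite asinK ?in_itv /= ?sqrt_itv // sqr_sqrtr //; have /andP[] := frac_itv.
Qed.

Lemma sqr_cos_grover_angle : cos theta ^+ 2 = (N%:R - t%:R) / N%:R.
Proof. by rewrite cos2sin2 sqr_sin_grover_angle; field. Qed.

(** Produces the square root in the error bound from the first-order term of [sqr_sin_perturb]. *)
Lemma mulN_sin_cos_grover_angle :
  N%:R * `|sin theta * cos theta| = Num.sqrt (t%:R * (N%:R - t%:R)).
Proof.
rewrite -[LHS]ger0_norm ?mulr_ge0 // -sqrtr_sqr; congr Num.sqrt.
rewrite exprMn real_normK ?num_real // exprMn.
by rewrite sqr_sin_grover_angle sqr_cos_grover_angle; field.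
Qed.

(* For [t = 0] or [t = N] one of the inverses is [0^-1 = 0],
   multiplying an amplitude that vanishes. *)
Definition good_part (x : 'I_N) : R := if f x then (sin theta)^-1 / Num.sqrt N%:R else 0.
Definition bad_part (x : 'I_N) : R := if f x then 0 else (cos theta)^-1 / Num.sqrt N%:R.

(** The angle is left free, so that the operators below act as maps on angles. *)
Definition grover_state (a : R) : 'cV[C]_N :=
  \col_x (sin a * good_part x + cos a * bad_part x)%:C.

Let sin_neq0 x : f x -> sin theta != 0.
Proof.
move=> fx; rewrite -sqrf_eq0 sqr_sin_grover_angle mulf_neq0 ?invr_eq0 // pnatr_eq0.
by rewrite -lt0n; apply/card_gt0P; exists x.
Qed.

Let cos_neq0 x : ~~ f x -> cos theta != 0.
Proof.
move=> fx; rewrite -sqrf_eq0 sqr_cos_grover_angle mulf_neq0 ?invr_eq0 //.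
rewrite -natrB // pnatr_eq0 -lt0n subn_gt0 -[X in (_ < X)%N]card_ord.
rewrite -(cardC [pred x | f x]) -[ltnLHS]addn0 ltn_add2l.
by apply/card_gt0P; exists x.
Qed.

Lemma grover_state_angle : grover_state theta = const_mx (Num.sqrt N%:R)^-1%:C.
Proof.
apply/matrixP => x j; rewrite !mxE; congr (_%:C).
rewrite /good_part /bad_part; case: ifPn => fx; rewrite mulr0 ?addr0 ?add0r.
  by rewrite mulrA divff ?mul1r // (sin_neq0 fx).
by rewrite mulrA divff ?mul1r // (cos_neq0 fx).
Qed.

Lemma reflectionE : QFT R N *m S_0 R N *m invmx (QFT R N) =
  1%:M - const_mx (2 / N%:R : R)%:C.
Proof.
(* [S_0 = 1 - 2 |0><0|]; conjugation by the Fourier transform turns [|0>] into the uniform vector,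
   whose projector has all entries [1 / N]. *)
have -> : S_0 R N = 1%:M - 2%:R *: (ket0 R N *m (ket0 R N)^T).
  apply/matrixP => i j; rewrite !mxE big_ord1 !mxE -natrM.
  case: eqVneq => [<-|ij]; first by case: eqP => _ /=; ring.
  have [i0|] := eqVneq (i : nat) 0%N; rewrite ?mul0n ?mulr0 ?subr0 //.
  have [j0|] := eqVneq (j : nat) 0%N; rewrite ?mulr0 ?subr0 //.
  by case/eqP: ij; apply: val_inj; rewrite /= i0.
rewrite (invmx_QFT R N_gt0) mulmxBr mulmx1 mulmxBl (QFT_dft_conj R N_gt0).
rewrite -scalemxAr -scalemxAl mulmxA (QFT_ket0 R N_gt0) -mulmxA (ket0_dft_conj R N_gt0).
congr (_ - _); apply/matrixP => i j; rewrite !mxE big_ord1 !mxE -rmorphM /=.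
by rewrite -invfM -expr2 sqr_sqrtr ?ltW // -(rmorph_nat (real_complex R)) -rmorphM.
Qed.

Let sum_good_const (F : R) : \sum_(x < N) (if f x then F else 0) = F * t%:R.
Proof. by rewrite -big_mkcond sumr_const -(mulr_natr F). Qed.

Let sum_bad_const (F : R) : \sum_(x < N) (if f x then 0 else F) = F * (N%:R - t%:R).
Proof.
rewrite mulrBr -sum_good_const -[in F * _](card_ord N) mulr_natr -sumr_const -sumrB.
by apply: eq_bigr => x _; case: ifP; rewrite ?subrr ?subr0.
Qed.

Let sqrtN_neq0 : Num.sqrt N%:R != 0 :> R.
Proof. by rewrite gt_eqF // sqrtr_gt0. Qed.

(** Valid also at [a = 0], where the inverse is [0]; this spares the two sums below a case split on
    [t = 0] and [t = N]. *)
Let mulVsqr (a : R) : a^-1 * a ^+ 2 = a.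
Proof. by have [->|a0] := eqVneq a 0; [rewrite expr0n mulr0 | field]. Qed.

Let tE : t%:R = N%:R * sin theta ^+ 2.
Proof. by rewrite sqr_sin_grover_angle; field. Qed.

Let NtE : N%:R - t%:R = N%:R * cos theta ^+ 2.
Proof. by rewrite sqr_cos_grover_angle; field. Qed.

Let sum_good_part : \sum_(x < N) good_part x = N%:R / Num.sqrt N%:R * sin theta.
Proof.
rewrite sum_good_const tE -[in RHS](mulVsqr (sin theta)); ring.
Qed.

Let sum_bad_part : \sum_(x < N) bad_part x = N%:R / Num.sqrt N%:R * cos theta.
Proof.
rewrite sum_bad_const NtE -[in RHS](mulVsqr (cos theta)); ring.
Qed.

Lemma S_f_grover_state a : S_f R f *m grover_state a = grover_state (- a).
Proof.
apply/matrixP => x j; rewrite !mxE (bigD1 x) //= big1 ?addr0 => [|i ix].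
  rewrite !mxE eqxx sinN cosN /good_part /bad_part; case: ifP => fx.
    by rewrite expr1 mulN1r -rmorphN /= !mulr0 !addr0 mulNr.
  by rewrite expr0 mul1r !mulr0 !add0r.
by rewrite !mxE eq_sym (negPf ix) mul0r.
Qed.

(** A product of two reflections: [S_f] sends the angle [a] to [- a], and the remaining factor
    [2 |u><u| - 1] reflects in the uniform vector [u], at angle [theta]. *)
Lemma Qop_grover_state a :
  Qop (QFT R N) f *m grover_state a = grover_state (a + 2 * theta).
Proof.
rewrite /Qop reflectionE mulNmx -mulmxA S_f_grover_state mulmxBl mul1mx.
apply/matrixP => x j; rewrite !mxE.
under eq_bigr do rewrite !mxE -rmorphM /=.
rewrite -rmorph_sum -mulr_sumr big_split /= -!mulr_sumr sum_good_part sum_bad_part.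
rewrite -rmorphB -rmorphN /=; congr (_%:C).
(* Centring both angles at [theta] collapses the inner product with the uniform vector to a multiple
   of [cos (a + theta)]. *)
have -> : - a = theta - (a + theta) by ring.
have -> : a + 2 * theta = theta + (a + theta) by ring.
have -> : 2 / N%:R * (sin (theta - (a + theta)) * (N%:R / Num.sqrt N%:R * sin theta)
    + cos (theta - (a + theta)) * (N%:R / Num.sqrt N%:R * cos theta))
    = 2 * cos (a + theta) / Num.sqrt N%:R.
  transitivity (2 / Num.sqrt N%:R * (cos theta * cos (theta - (a + theta)) +
      sin theta * sin (theta - (a + theta)))).
    by field; rewrite NR_neq0 sqrtN_neq0.
  by rewrite -cosB subKr mulrAC.
move: (a + theta) => b; rewrite sinB cosB sinD cosD /good_part /bad_part.
by case: ifPn => [/sin_neq0 s0|/cos_neq0 c0]; field; rewrite sqrtN_neq0 ?s0 ?c0.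
Qed.

Lemma Qop_exp_grover_state j :
  Qop (QFT R N) f ^+ j *m grover_state theta = grover_state ((2 * j%:R + 1) * theta).
Proof.
elim: j => [|j IH]; first by rewrite expr0 mulr0 add0r mul1r mul1mx.
rewrite exprS -mulmxE -mulmxA IH Qop_grover_state; congr grover_state.
by rewrite -natr1; ring.
Qed.

(** * Amplitudes after the inverse transform, and the distribution of the outcome *)

Definition fourier_sum (u : nat -> R) (y : 'I_M) : C :=
  (M%:R^-1)%:C * \sum_(j < M) expi (- (2 * pi * (j%:R * y%:R) / M%:R)) * (u j)%:C.

Let sin_amp := fourier_sum (fun j => sin ((2 * j%:R + 1) * theta)).
Let cos_amp := fourier_sum (fun j => cos ((2 * j%:R + 1) * theta)).

(** Branch [j] holds the state at angle [(2j+1) theta], and the inverse transform acts on [j] only,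
    so the two parts factor out. *)
Lemma est_amp_stateE y x : est_amp_state M (QFT R N) f y x =
  (good_part x)%:C * sin_amp y + (bad_part x)%:C * cos_amp y.
Proof.
have init : apply_first (QFT R M) (init_state M (QFT R N)) =
    (Num.sqrt M%:R)^-1%:C *: const_mx 1 *m (grover_state theta)^T.
  have -> : init_state M (QFT R N) = ket0 R M *m (QFT R N *m ket0 R N)^T.
    by apply/matrixP => j z; rewrite !mxE big_ord1 !mxE.
  rewrite /apply_first mulmxA (QFT_ket0 R M_gt0) (QFT_ket0 R N_gt0) grover_state_angle.
  by congr (_ *m _); apply/matrixP => j z; rewrite !mxE mulr1.
have lam : Lambda (Qop (QFT R N) f) (apply_first (QFT R M) (init_state M (QFT R N))) =
    \matrix_(j, z) ((Num.sqrt M%:R)^-1%:C * grover_state ((2 * j%:R + 1) * theta) z ord0).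
  apply/matrixP => j z; rewrite init /Lambda [LHS]mxE [RHS]mxE -Qop_exp_grover_state.
  rewrite row_mul trmx_mul trmxK.
  have -> : (row j ((Num.sqrt M%:R)^-1%:C *: const_mx 1 : 'cV[C]_M))^T = (Num.sqrt M%:R)^-1%:C%:M.
    by apply/matrixP => p q; rewrite !mxE !ord1 eqxx mulr1.
  by rewrite mul_mx_scalar -scalemxAr mxE.
rewrite /est_amp_state lam /apply_first (invmx_QFT R M_gt0) mxE.
rewrite /sin_amp /cos_amp /fourier_sum mulrCA [X in _ + X]mulrCA -mulrDr.
rewrite !mulr_sumr -big_split mulr_sumr /=; apply: eq_bigr => j _.
(* The factors [M^(-1/2)] of the preparation and of the inverse transform combine to [1 / M]. *)
rewrite !mxE mulrACA -rmorphM /= -invfM -expr2 sqr_sqrtr ?ler0n //.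
rewrite rmorphD !rmorphM /=; ring.
Qed.

(** Successive angles differ by [2 theta], whose sine vanishes as well. This covers the degenerate
    case in which [good_part] is not normalized. *)
Let sin_amp0 y : sin theta = 0 -> sin_amp y = 0.
Proof.
move=> s0; rewrite /sin_amp /fourier_sum big1 ?mulr0 // => j _.
have -> : sin ((2 * j%:R + 1) * theta) = 0; last by rewrite mulr0.
elim: (nat_of_ord j) => [|n IH]; first by rewrite mulr0 add0r mul1r.
have -> : (2 * n.+1%:R + 1) * theta = (2 * n%:R + 1) * theta + theta *+ 2.
  by rewrite -natr1; ring.
by rewrite sinD sin_mulr2n IH s0 mulr0 mul0rn mulr0 mul0r addr0.
Qed.

Let cos_amp0 y : cos theta = 0 -> cos_amp y = 0.
Proof.
move=> c0; rewrite /cos_amp /fourier_sum big1 ?mulr0 // => j _.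
have -> : cos ((2 * j%:R + 1) * theta) = 0; last by rewrite mulr0.
elim: (nat_of_ord j) => [|n IH]; first by rewrite mulr0 add0r mul1r.
have -> : (2 * n.+1%:R + 1) * theta = (2 * n%:R + 1) * theta + theta *+ 2.
  by rewrite -natr1; ring.
by rewrite cosD sin_mulr2n IH c0 !mul0r mul0rn mulr0 subr0.
Qed.

Let x0 : R := M%:R * theta / pi.

Let pi_neq0 : pi != 0. Proof. by rewrite gt_eqF ?pi_gt0. Qed.

(** As [2 j theta = 2 pi j x0 / M], the phase [(2j+1) theta] shifts [y] by [x0], up to the constant
    phase [theta]. *)
Let amp_add y :
  cos_amp y + 'i * sin_amp y = expi theta *
  ((M%:R^-1)%:C * \sum_(j < M) expi (- (2 * pi * (j%:R * (y%:R - x0)) / M%:R))).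
Proof.
rewrite /cos_amp /sin_amp /fourier_sum (mulrCA 'i) -mulrDr (mulrCA (expi theta)).
rewrite !mulr_sumr -big_split !mulr_sumr /=; apply: eq_bigr => j _; congr (_ * _).
rewrite (mulrCA 'i) -mulrDr.
have -> : (cos ((2 * j%:R + 1) * theta))%:C + 'i * (sin ((2 * j%:R + 1) * theta))%:C
   = expi ((2 * j%:R + 1) * theta) by rewrite /expi; simpc.
by rewrite -!expiD; congr expi; rewrite /x0; move: pi pi_neq0 => p p0; field; rewrite MR_neq0 p0.
Qed.

Let amp_sub y :
  cos_amp y - 'i * sin_amp y = expi (- theta) *
  ((M%:R^-1)%:C * \sum_(j < M) expi (- (2 * pi * (j%:R * (y%:R + x0)) / M%:R))).
Proof.
rewrite /cos_amp /sin_amp /fourier_sum (mulrCA 'i) -mulrBr (mulrCA (expi (- theta))).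
rewrite !mulr_sumr -sumrB !mulr_sumr /=; apply: eq_bigr => j _; congr (_ * _).
rewrite (mulrCA 'i) -mulrBr.
have -> : (cos ((2 * j%:R + 1) * theta))%:C - 'i * (sin ((2 * j%:R + 1) * theta))%:C
   = expi (- ((2 * j%:R + 1) * theta)) by rewrite expiN /expi; simpc.
by rewrite -!expiD; congr expi; rewrite /x0; move: pi pi_neq0 => p p0; field; rewrite MR_neq0 p0.
Qed.

Lemma est_amp_probE (y : 'I_M) :
  est_amp_prob (QFT R N) f y = (fejer M (y%:R - x0) + fejer M (y%:R + x0)) / 2.
Proof.
have par := sqnorm_parallelogram (cos_amp y) (sin_amp y).
rewrite amp_add amp_sub !(sqnormM (expi _)) !sqnorm_expi !mul1r in par.
rewrite /fejer par mulrAC divff ?mul1r ?pnatr_eq0 //.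
rewrite /est_amp_prob; under eq_bigr do rewrite est_amp_stateE.
transitivity (\sum_(x < N) ((if f x then sqnorm (sin_amp y) * (sin theta ^- 2 / N%:R) else 0)
   + (if f x then 0 else sqnorm (cos_amp y) * (cos theta ^- 2 / N%:R)))).
  apply: eq_bigr => x _; rewrite /good_part /bad_part.
  case: ifP => _; rewrite mul0r ?addr0 ?add0r sqnormM sqnorm_real mulrC;
    by rewrite exprMn !exprVn sqr_sqrtr ?ler0n.
rewrite big_split /= sum_good_const sum_bad_const NtE tE addrC; congr (_ + _).
  (* The total weight of [bad_part] is [1] unless the cosine vanishes, and then so does the
     amplitude. *)
  have [c0|c0] := eqVneq (cos theta) 0.
    by rewrite cos_amp0 // /sqnorm /= expr0n addr0 !mul0r.
  by field; rewrite NR_neq0 c0.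
have [s0|s0] := eqVneq (sin theta) 0.
  by rewrite sin_amp0 // /sqnorm /= expr0n addr0 !mul0r.
by field; rewrite NR_neq0 s0.
Qed.

(** Since [pi x0 / M = theta], the output can be written through the displacement [y - x0] or
    [y + x0] alone, the form that the window bounds require. *)
Lemma count_probE (Q : R -> bool) : count_prob M f Q =
  (\sum_(y < M | Q (N%:R * sin (pi * (y%:R + - x0) / M%:R + theta) ^+ 2)) fejer M (y%:R + - x0)
 + \sum_(y < M | Q (N%:R * sin (pi * (y%:R + x0) / M%:R - theta) ^+ 2)) fejer M (y%:R + x0)) / 2.
Proof.
rewrite /count_prob; under eq_bigr do rewrite est_amp_probE.
rewrite -mulr_suml big_split /=; congr ((_ + _) / 2); apply: eq_bigl => y;
  rewrite /count_out /est_amp_out; congr (Q (_ * sin _ ^+ 2));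
  by rewrite /x0; move: pi pi_neq0 => p p0; field; rewrite MR_neq0 p0.
Qed.

(** * The error bound and the success probabilities *)

Let sqr_sin_shift (m a : R) :
  sin (pi * (m + M%:R) / M%:R + a) ^+ 2 = sin (pi * m / M%:R + a) ^+ 2.
Proof.
have -> : pi * (m + M%:R) / M%:R + a = pi * m / M%:R + a + pi by field.
by rewrite sinDpi sqrrN.
Qed.

Let bound (k : nat) : R :=
  2 * pi * k%:R * Num.sqrt (t%:R * (N%:R - t%:R)) / M%:R
    + pi ^+ 2 * k%:R ^+ 2 * N%:R / M%:R ^+ 2.

(** Here [a] stands for [theta] or [- theta]; apply [sqr_sin_perturb] with [d = pi m / M]. *)
Lemma count_error_le k (m a : R) :
  sin a ^+ 2 = sin theta ^+ 2 -> `|sin a * cos a| = `|sin theta * cos theta| ->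
  `|m| <= k%:R -> `|N%:R * sin (pi * m / M%:R + a) ^+ 2 - t%:R| <= bound k.
Proof.
move=> sa ca mk; have pi0 := pi_gt0 R.
have MR_gt0 : 0 < M%:R :> R by rewrite ltr0n.
rewrite tE -sa -mulrBr normrM ger0_norm // [pi * m / _ + a]addrC.
apply: (@le_trans _ _ (N%:R * (2 * `|pi * m / M%:R| * `|sin a * cos a| + (pi * m / M%:R) ^+ 2))).
  by rewrite ler_wpM2l // sqr_sin_perturb.
rewrite mulrDr ca /bound -mulN_sin_cos_grover_angle.
have -> : `|pi * m / M%:R| = pi * `|m| / M%:R.
  by rewrite !normrM normfV (gtr0_norm pi0) (gtr0_norm MR_gt0).
apply: lerD.
  set v := `|_ * cos _|.
  have -> : N%:R * (2 * (pi * `|m| / M%:R) * v) = 2 * pi * (N%:R * v) / M%:R * `|m| by ring.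
  have -> : 2 * pi * k%:R * (N%:R * v) / M%:R = 2 * pi * (N%:R * v) / M%:R * k%:R by ring.
  have v_ge0 : 0 <= v by exact: normr_ge0.
  by rewrite ler_wpM2l // !mulr_ge0 ?invr_ge0 // ltW.
have -> : N%:R * (pi * m / M%:R) ^+ 2 = pi ^+ 2 * N%:R / M%:R ^+ 2 * `|m| ^+ 2.
  by rewrite real_normK ?num_real //; field.
have -> : pi ^+ 2 * k%:R ^+ 2 * N%:R / M%:R ^+ 2 = pi ^+ 2 * N%:R / M%:R ^+ 2 * k%:R ^+ 2 by ring.
rewrite ler_wpM2l ?lerXn2r ?nnegrE //.
by rewrite !mulr_ge0 ?invr_ge0 ?exprn_ge0 // ltW.
Qed.

Let good k (t' : R) := `|t' - t%:R| <= bound k.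

Let good_shift k a m : good k (N%:R * sin (pi * (m + M%:R) / M%:R + a) ^+ 2) =
  good k (N%:R * sin (pi * m / M%:R + a) ^+ 2).
Proof. by rewrite sqr_sin_shift. Qed.

Let good_near k m : `|m| <= k%:R -> good k (N%:R * sin (pi * m / M%:R + theta) ^+ 2).
Proof. exact: count_error_le. Qed.

Let good_nearN k m : `|m| <= k%:R -> good k (N%:R * sin (pi * m / M%:R - theta) ^+ 2).
Proof. by apply: count_error_le; rewrite sinN ?sqrrN // cosN mulNr normrN. Qed.

(** Each of the two kernels has at least this mass on its own window, and the probability is their
    average. *)
Lemma count_prob_ge k : (0 < k)%N -> 8 / pi ^+ 2 <= count_prob M f (good k).
Proof.
move=> k0; rewrite count_probE.
have := fejer_window_ge M_gt0 (good_shift k theta) (@good_near k) (- x0) k0.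
have := fejer_window_ge M_gt0 (good_shift k (- theta)) (@good_nearN k) x0 k0.
lra.
Qed.

Lemma count_prob_gt k : (2 <= k)%N -> 1 - (2 * (k%:R - 1))^-1 < count_prob M f (good k).
Proof.
move=> k2; rewrite count_probE.
have := fejer_window_gt M_gt0 (good_shift k theta) (@good_near k) (- x0) k2.
have := fejer_window_gt M_gt0 (good_shift k (- theta)) (@good_nearN k) x0 k2.
lra.
Qed.

(** * The exact cases [t = 0] and [t = N] *)

Lemma count_prob_none : t = 0%N -> count_prob M f (fun t' => t' == 0 :> R) = 1.
Proof.
move=> t0; have th0 : theta = 0.
  rewrite /theta -/t t0 mul0r sqrtr0 -[in LHS](@sin0 R) sinK // in_itv /=.
  by rewrite oppr_le0 andbb divr_ge0 ?pi_ge0.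
rewrite /count_prob (bigD1 (Ordinal M_gt0)) /=; last first.
  by rewrite /count_out /est_amp_out mulr0 mul0r sin0 expr0n mulr0.
(* With [x0 = 0] both kernels equal [1] at the outcome [0] and vanish at all others. *)
rewrite big1 => [|y /andP[_ y0]].
  by rewrite est_amp_probE /x0 th0 mulr0 mul0r subr0 !addr0 fejer0 //; field.
rewrite est_amp_probE /x0 th0 mulr0 mul0r subr0 !addr0 fejer_int ?addr0 ?mul0r //.
by rewrite lt0n ltn_ord andbT.
Qed.

(** Evenness makes the peak [x0 = M / 2] an actual outcome, and [x0] and [- x0] agree modulo [M]. *)
Lemma count_prob_all : t = N -> ~~ odd M -> count_prob M f (fun t' => t' == N%:R :> R) = 1.
Proof.
move=> tN evM; have thpi : theta = pi / 2.
  rewrite /theta -/t tN divff // sqrtr1.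
  have -> : asin 1 = asin (sin (pi / 2)) by rewrite sin_pihalf.
  rewrite sinK // in_itv /=.
  by have := pi_gt0 R; lra.
have ltM2 : (M./2 < M)%N by clear -M_gt0; lia.
have ME : M%:R = 2 * M./2%:R :> R by rewrite -natrM mul2n even_halfK.
have x0E : x0 = M./2%:R.
  by rewrite /x0 thpi ME; move: pi pi_neq0 => p p0; field.
have diff (y : 'I_M) : fejer M (y%:R - x0 : R) = fejer M (y%:R + x0 : R).
  by rewrite -(fejerDM M_gt0) ME x0E; congr fejer; ring.
rewrite /count_prob (bigD1 (Ordinal ltM2)) /=; last first.
  rewrite /count_out /est_amp_out /= ME.
  have -> : pi * M./2%:R / (2 * M./2%:R) = pi / 2.
    by field; move: MR_neq0; rewrite ME mulf_eq0 negb_or => /andP[].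
  by rewrite sin_pihalf expr1n mulr1.
rewrite big1 => [|y /andP[_ y0]].
  by rewrite est_amp_probE -diff x0E /= subrr fejer0 // addr0; field.
(* The two kernels agree, so whichever of [y + x0] and [y - x0] lies strictly between [0] and [M]
   can be used. *)
rewrite est_amp_probE; have [ylt|yge] := ltnP y M./2.
  by rewrite diff x0E -natrD fejer_int ?addr0 ?mul0r //;
     clear -ylt M_gt0 evM; lia.
rewrite -diff x0E -natrB // fejer_int ?addr0 ?mul0r //.
have yne : y != M./2 :> nat by rewrite -val_eqE in y0.
by clear -yge yne M_gt0; have := ltn_ord y; lia.
Qed.

End Counting.

Theorem theorem7 (R : realType) (N M k : nat) (f : 'I_N -> bool) :
  (0 < N)%N -> (0 < M)%N -> (0 < k)%N ->
  let t : nat := #|[pred x | f x]| in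
  let bound : R :=
    2 * pi * k%:R * Num.sqrt (t%:R * (N%:R - t%:R)) / M%:R
    + pi ^+ 2 * k%:R ^+ 2 * N%:R / M%:R ^+ 2 in
  let good : R -> bool := fun t' => `|t' - t%:R| <= bound in
  ((k = 1)%N -> 8 / pi ^+ 2 <= count_prob (R := R) M f good) /\
  ((2 <= k)%N -> 1 - (2 * (k%:R - 1))^-1 < count_prob (R := R) M f good) /\
  ((t = 0)%N -> count_prob (R := R) M f (fun t' => t' == 0) = 1) /\
  ((t = N)%N -> ~~ odd M -> count_prob (R := R) M f (fun t' => t' == N%:R) = 1).
Proof.
move=> N0 M0 k0 t bound good; split; first by move=> _; exact: count_prob_ge.
split; first exact: count_prob_gt.
by split; [exact: count_prob_none | exact: count_prob_all].
Qed.
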